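(* Let $n\ge 4$ be an integer, let $\mathbf{p}=(p_1,\ldots,p_n)$ be a signature (a sequence of positive integers with $\sum_{i=1}^n 1/p_i<1$), and let $R$ be its canonical ring. If $R$ is a hypersurface, then its $a$-invariant satisfies $a(R)=1$.
   Context: Let $n\ge 4$. A signature is a sequence $\mathbf{p}=(p_1,\ldots,p_n)$ of positive integers with $\sum_{i=1}^n \frac1{p_i}<1$. Let $L$ be the rank-one abelian group $L=(\mathbb{Z}\vec{X}_1\oplus\cdots\oplus\mathbb{Z}\vec{X}_n\oplus\mathbb{Z}\vec{c})/(p_i\vec{X}_i-\vec{c} : 1\le i\le n)$, and let $T=\mathbb{C}[X_1,\ldots,X_n]/(\sum_{i=1}^n X_i^{p_i})$, graded by $L$ with $X_i$ in degree $\vec{X}_i$; write $T_{\vec v}$ for the degree $\vec v$ part. The dualizing element is $\vec\omega=\vec c-\sum_{i=1}^n\vec X_i\in L$, and the canonical ring is the $\mathbb{Z}$-graded subring $R=\bigoplus_{k=0}^\infty R_k$ of $T$, with $R_k=T_{k\vec\omega}$. Let $\mathfrak m=\bigoplus_{k\ge1}R_k$. The embedding dimension of $R$ is $\dim_{\mathbb C}\mathfrak m/\mathfrak m^2$, and $R$ is called a hypersurface if its embedding dimension equals its Krull dimension plus one (as $R$ has Krull dimension $n-1$, this means $\dim_{\mathbb C}\mathfrak m/\mathfrak m^2=n$). The $a$-invariant $a(R)\in\mathbb Z$ of a graded Gorenstein ring $R$ is defined by $K_R=R(a)$, where $K_R$ is the graded canonical module. If $R$ is a hypersurface generated by $n$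 homogeneous elements of degrees $a_1,\ldots,a_n$ with one relation of degree $h$, then $a(R)=h-a_1-\cdots-a_n$. *)

(* Defs.v *)
(* Classical logic (boolp) turns membership in an ideal, a subgroup or a subring
   into a boolean predicate. *)
From HB Require Import structures.
From mathcomp Require Import all_boot all_order all_algebra ring_quotient.
From mathcomp Require Import boolp mpoly.

Set Implicit Arguments.
Unset Strict Implicit.
Unset Printing Implicit Defensive.

Import GRing.Theory Num.Theory.

Local Open Scope ring_scope.
Local Open Scope quotient_scope.

(* -------------------------------------------------------------------------- *)
(* Invariants of an N-graded commutative k-algebra A = \bigoplus_m G m, where *)
(* G m is the set of homogeneous elements of degree m (0 included).           *)
(* -------------------------------------------------------------------------- *)
Section GradedAlgebra.

Variables (k : fieldType) (A : comAlgType k).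

Definition prime_ideal (P : {pred A}) : Prop :=
  idealr_closed P /\ prime_idealr_closed P.

Definition prime_chain (d : nat) (P : nat -> {pred A}) : Prop :=
  (forall i, (i <= d)%N -> prime_ideal (P i)) /\
  (forall i, (i < d)%N ->
     {subset P i <= P i.+1} /\ exists2 x, x \in P i.+1 & x \notin P i).

Definition krull_dim (d : nat) : Prop :=
  (exists P, prime_chain d P) /\
  (forall e P, prime_chain e P -> (e <= d)%N).

Variable G : nat -> A -> Prop.

Definition irrelevant_ideal (x : A) : Prop :=
  exists (N : nat) (y : nat -> A),
    (forall m, G m (y m)) /\ x = \sum_(1 <= m < N) y m.

Definition irrelevant_ideal_sq (x : A) : Prop :=
  exists (N : nat) (u v : nat -> A),
    (forall i, irrelevant_ideal (u i) /\ irrelevant_ideal (v i)) /\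
    x = \sum_(i < N) u i * v i.

(* dim_k m/m^2 = e: the classes of x_1, ..., x_e form a basis of m/m^2. *)
Definition embedding_dim (e : nat) : Prop :=
  exists x : 'I_e -> A,
    [/\ forall i, irrelevant_ideal (x i),
        forall y, irrelevant_ideal y ->
          exists c : 'I_e -> k, irrelevant_ideal_sq (y - \sum_i c i *: x i)
      & forall c : 'I_e -> k,
          irrelevant_ideal_sq (\sum_i c i *: x i) -> forall i, c i = 0].

Definition hypersurface : Prop :=
  exists d, krull_dim d /\ embedding_dim d.+1.

Definition degree_part (j : int) (x : A) : Prop :=
  if j is Posz m then G m x else x = 0.

(* Homogeneous system of parameters x_1, ..., x_d with deg x_i = e_i > 0, as a
   homogeneous Noether normalization: A is a finite module over the polynomial
   ring k[x_1, ..., x_d].  The length d is then the Krull dimension of A. *)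
Definition hsop (d : nat) (x : 'I_d -> A) (e : 'I_d -> nat) : Prop :=
  [/\ forall i, (0 < e i)%N /\ G (e i) (x i),
      forall q : {mpoly k[d]}, mmap (in_alg A) x q = 0 -> q = 0
    & exists (r : nat) (b : 'I_r -> A), forall y, exists q : 'I_r -> {mpoly k[d]},
        y = \sum_s mmap (in_alg A) x (q s) * b s].

(* The graded canonical module is the graded k-dual of top local cohomology:
   K_A = \bigoplus_j Hom_k(H^d_m(A)_(-j), k).  For an hsop x with product
   X = x_1 ... x_d, the top Cech cohomology A_X / \sum_i A_(X / x_i) is
     H^d_m(A) = colim (A/(x^0) -> A/(x^1) -> A/(x^2) -> ...),
   where (x^t) = (x_1^t, ..., x_d^t), the maps are multiplication by X, and the
   class of y in A/(x^t) stands for y / X^t, of degree deg y - t deg X.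
   A linear form on this colimit is a compatible family phi_t : A -> k of linear
   forms with phi_t = 0 on (x^t); here phi t y is the value at y / X^t.  It has
   degree j when it vanishes on all homogeneous elements of degree <> - j. *)
Definition canonical_module (d : nat) (x : 'I_d -> A) (e : 'I_d -> nat)
    (j : int) (phi : nat -> A -> k) : Prop :=
  [/\ forall t c y z, phi t (c *: y + z) = c * phi t y + phi t z,
      forall t i y, phi t (x i ^+ t * y) = 0,
      forall t y, phi t.+1 ((\prod_i x i) * y) = phi t y
    & forall t m y, G m y -> m%:Z - (t * \sum_i e i)%:Z != - j -> phi t y = 0].

(* a(A) = a, i.e. K_A = A(a): there is a degree-preserving isomorphism of
   A-modules Phi from A(a), where A(a)_j = A_(j + a), to K_A, on which A acts by
   (y . phi) t w = phi t (y * w).  Local cohomology, hence K_A, does not depend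
   on the system of parameters used to compute it. *)
Definition a_invariant (a : int) : Prop :=
  exists (d : nat) (x : 'I_d -> A) (e : 'I_d -> nat),
    hsop x e /\
    exists Phi : A -> nat -> A -> k,
      [/\ forall y z t w, Phi (y + z) t w = Phi y t w + Phi z t w,
          forall y z t w, Phi (y * z) t w = Phi z t (y * w),
          forall j y, degree_part (j + a) y -> canonical_module x e j (Phi y)
        & forall j phi, canonical_module x e j phi ->
            exists! y, degree_part (j + a) y /\ Phi y = phi].

End GradedAlgebra.

(* -------------------------------------------------------------------------- *)

Record signature (n : nat) := Signature {
  sig_val :> 'I_n -> nat;
  sig_gt0 : forall i, (0 < sig_val i)%N;
  sig_lt1 : \sum_i (sig_val i)%:R^-1 < 1 :> rat
}.

Section GradingGroup.

Variables (n : nat) (p : signature n).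

(* (v, l) stands for \sum_i v_i X_i + l c. *)
Definition Lfree : Type := ({ffun 'I_n -> int} * int)%type.
HB.instance Definition _ := GRing.Zmodule.on Lfree.

(* The subgroup spanned by the elements p_i X_i - c. *)
Definition Lrel : {pred Lfree} := fun v =>
  `[< exists s : {ffun 'I_n -> int},
        v = ([ffun i => s i * (p i)%:Z], - \sum_i s i) >].

Fact Lrel_zmod_closed : zmod_closed Lrel.
Proof.
split; first by apply/asboolP; exists 0; congr pair;
  [apply/ffunP=> i; rewrite !ffunE mul0r
  |rewrite big1 ?oppr0 // => i _; rewrite ffunE].
move=> u v /asboolP[s ->] /asboolP[t ->]; apply/asboolP; exists (s - t).
congr pair; first by apply/ffunP=> i; rewrite !ffunE mulrBl.
by rewrite -opprD -sumrB; congr (- _); apply: eq_bigr => i _; rewrite !ffunE.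
Qed.
HB.instance Definition _ := GRing.isZmodClosed.Build Lfree Lrel Lrel_zmod_closed.

Definition L : zmodType := Quotient.quot Lrel.

Definition Lx (i : 'I_n) : L := \pi_(L) (([ffun l => (l == i)%:R], 0) : Lfree).
Definition Lc : L := \pi_(L) ((0, 1) : Lfree).

Definition dualizing : L := Lc - \sum_i Lx i.

Definition monomial_degree (m : 'X_{1..n}) : L := \sum_i Lx i *+ m i.

End GradingGroup.

Section FermatRing.

Variables (k : fieldType) (n : nat) (p : signature n).

Definition fermat_poly : {mpoly k[n]} := \sum_i 'X_i ^+ p i.

Definition fermat_ideal : {pred {mpoly k[n]}} := fun q =>
  `[< exists g, q = g * fermat_poly >].

Fact fermat_ideal_closed : idealr_closed fermat_ideal.
Proof.
split; first by apply/asboolP; exists 0; rewrite mul0r.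
- apply/asboolP=> -[g /(congr1 (meval (fun=> 0)))].
  rewrite rmorph1 rmorphM /= [X in _ * X](_ : _ = 0) ?mulr0.
    by move/eqP; rewrite oner_eq0.
  rewrite /fermat_poly rmorph_sum big1 //= => i _.
  by rewrite rmorphXn /= mevalXU expr0n eqn0Ngt sig_gt0.
- move=> a u v /asboolP[g ->] /asboolP[h ->]; apply/asboolP.
  by exists (a * g + h); rewrite mulrDl mulrA.
Qed.
HB.instance Definition _ :=
  isIdealr.Build {mpoly k[n]} fermat_ideal fermat_ideal_closed.

Definition T : Type := {ideal_quot fermat_ideal}.
HB.instance Definition _ := GRing.ComNzRing.on T.

Definition T_pi (q : {mpoly k[n]}) : T := \pi_({ideal_quot fermat_ideal}) q.

Definition T_scale (c : k) (x : T) : T := T_pi c%:MP * x.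

Fact T_pi1 : T_pi 1 = 1. Proof. exact: rmorph1. Qed.
Fact T_piD q r : T_pi (q + r) = T_pi q + T_pi r. Proof. exact: rmorphD. Qed.
Fact T_piM q r : T_pi (q * r) = T_pi q * T_pi r. Proof. exact: rmorphM. Qed.

Fact T_scaleA a b x : T_scale a (T_scale b x) = T_scale (a * b) x.
Proof. by rewrite /T_scale mulrA -T_piM mpolyCM. Qed.
Fact T_scale1 : left_id 1 T_scale.
Proof. by move=> x; rewrite /T_scale mpolyC1 T_pi1 mul1r. Qed.
Fact T_scaleDr : right_distributive T_scale +%R.
Proof. by move=> a x y; rewrite /T_scale mulrDr. Qed.
Fact T_scaleDl x : {morph T_scale^~ x : a b / a + b}.
Proof. by move=> a b; rewrite /T_scale mpolyCD T_piD mulrDl. Qed.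
HB.instance Definition _ :=
  GRing.Zmodule_isLmodule.Build k T T_scaleA T_scale1 T_scaleDr T_scaleDl.

Fact T_scaleAl (a : k) (x y : T) : a *: (x * y) = a *: x * y.
Proof. by rewrite /GRing.scale /= /T_scale mulrA. Qed.
HB.instance Definition _ := GRing.Lmodule_isLalgebra.Build k T T_scaleAl.
HB.instance Definition _ := GRing.Lalgebra_isComAlgebra.Build k T.

Definition T_homog (v : L p) (x : T) : Prop :=
  exists2 q : {mpoly k[n]}, T_pi q = x &
    {in msupp q, forall m, monomial_degree p m = v}.

Fact T_homog0 v : T_homog v 0.
Proof. by exists 0; [exact: rmorph0|move=> m; rewrite msupp0]. Qed.

Fact T_homogD v x y : T_homog v x -> T_homog v y -> T_homog v (x + y).
Proof.
move=> [q <- hq] [r <- hr]; exists (q + r); first exact: T_piD.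
by move=> m /msuppD_le; rewrite mem_cat => /orP[/hq|/hr].
Qed.

Fact T_homogZ v (a : k) x : T_homog v x -> T_homog v (a *: x).
Proof.
move=> [q <- hq]; exists (a%:MP * q); first exact: T_piM.
by move=> m; rewrite mul_mpolyC => /msuppZ_le /hq.
Qed.

Fact T_homog1 : T_homog 0 1.
Proof.
exists 1; first exact: T_pi1.
move=> m; rewrite msupp1 inE => /eqP ->.
by rewrite /monomial_degree big1 // => i _; rewrite mnm0E.
Qed.

Fact T_homogM v w x y : T_homog v x -> T_homog w y -> T_homog (v + w) (x * y).
Proof.
move=> [q <- hq] [r <- hr]; exists (q * r); first exact: T_piM.
move=> m /msuppM_le /allpairsP[[a b] /= [/hq <- /hr <- ->]].
rewrite /monomial_degree -big_split /=; apply: eq_bigr => i _.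
by rewrite mnmDE mulrnDr.
Qed.

(* R = \bigoplus_(m >= 0) T_(m omega), as a subset of T. *)
Definition canonical_subring : {pred T} := fun x =>
  `[< exists (N : nat) (y : nat -> T),
        (forall m, T_homog (dualizing p *+ m) (y m)) /\ x = \sum_(m < N) y m >].

Fact canonical_subringP x :
  reflect (exists (N : nat) (y : nat -> T),
    (forall m, T_homog (dualizing p *+ m) (y m)) /\ x = \sum_(m < N) y m)
  (x \in canonical_subring).
Proof. exact: asboolP. Qed.

Fact canonical_subring_homog m x :
  T_homog (dualizing p *+ m) x -> x \in canonical_subring.
Proof.
move=> hx; apply/canonical_subringP.
exists m.+1, (fun l => if l == m then x else 0); split=> [l|].
  by case: eqP => [->|_] //; apply: T_homog0.
rewrite big_ord_recr /= eqxx big1 ?add0r // => i _.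
by rewrite ltn_eqF.
Qed.

Fact canonical_subringD : {in canonical_subring &, forall x y,
  x + y \in canonical_subring}.
Proof.
have pad N M (y : nat -> T) : (N <= M)%N ->
    \sum_(m < N) y m = \sum_(m < M) (if (m < N)%N then y m else 0).
  by move=> NM; rewrite (big_ord_widen _ _ NM) big_mkcond.
move=> _ _ /canonical_subringP[N [y [hy ->]]] /canonical_subringP[M [z [hz ->]]].
apply/canonical_subringP; exists (N + M)%N.
exists (fun m => (if (m < N)%N then y m else 0) + (if (m < M)%N then z m else 0)).
split=> [m|]; last by rewrite big_split (pad _ _ y (leq_addr M N))
                              (pad _ _ z (leq_addl N M)).
by apply: T_homogD; case: ifP => _ //; apply: T_homog0.
Qed.

Fact canonical_subring_sum N (y : 'I_N -> T) :
  (forall i, y i \in canonical_subring) -> \sum_i y i \in canonical_subring.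
Proof.
move=> hy; apply: (big_ind (fun x => x \in canonical_subring)) => //.
  exact: (canonical_subring_homog (T_homog0 (dualizing p *+ 0))).
by move=> ? ?; apply: canonical_subringD.
Qed.

Fact canonical_subalg_closed : subalg_closed canonical_subring.
Proof.
have Z a : {in canonical_subring, forall x, a *: x \in canonical_subring}.
  move=> _ /canonical_subringP[N [y [hy ->]]]; rewrite scaler_sumr.
  apply: canonical_subring_sum => i; apply: canonical_subring_homog.
  exact/T_homogZ/hy.
split=> [|a x y hx hy|].
- exact: (@canonical_subring_homog 0%N _ T_homog1).
- by apply: canonical_subringD => //; apply: Z.
- move=> _ _ /canonical_subringP[N [y [hy ->]]] /canonical_subringP[M [z [hz ->]]].
  rewrite mulr_suml; apply: canonical_subring_sum => i; rewrite mulr_sumr.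
  apply: canonical_subring_sum => j.
  apply: (@canonical_subring_homog (i + j)%N).
  by rewrite mulrnDr; apply: T_homogM.
Qed.
HB.instance Definition _ :=
  GRing.isSubalgClosed.Build k T canonical_subring canonical_subalg_closed.

Record canonical_ring : Type := CanonicalRing {
  canonical_val :> T;
  canonical_valP : canonical_val \in canonical_subring
}.
HB.instance Definition _ := [isSub for canonical_val].
HB.instance Definition _ := [Choice of canonical_ring by <:].
HB.instance Definition _ := [SubChoice_isSubComNzRing of canonical_ring by <:].
HB.instance Definition _ := [SubZmodule_isSubLmodule of canonical_ring by <:].
HB.instance Definition _ := [SubNzRing_SubLmodule_isSubLalgebra of canonical_ring by <:].
HB.instance Definition _ := [SubLalgebra_isSubAlgebra of canonical_ring by <:].

Definition canonical_part (m : nat) (x : canonical_ring) : Prop :=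
  T_homog (dualizing p *+ m) (val x).

End FermatRing.

(* Main.v *)
(* T is free over C[X_i : i <> 0] on the powers X_0^b with b < p_0, which gives
   every element a normal form.  Since P omega = D c with P the product of the
   p_i and D > 0, the X_i^(p_i D), i <> 0, form a homogeneous system of
   parameters of R, all of degree P.  The residue at level t is the coefficient,
   in normal form, of the socle monomial
     X_0^(p_0 - 1) * prod_(i <> 0) X_i^(p_i D t - 1),
   whose degree is (t (n - 1) P + 1) omega.  If a and b are normal monomials, the
   residue of a * b is 1 when a b is the socle monomial and 0 otherwise: when X_0
   wraps around, the relation leaves an exponent of X_0 below p_0 - 1.  So
   monomials form dual bases, the pairing identifies R with K_R, and the summand
   1 in the socle degree is the shift a(R). *)
Require Import Defs.
From HB Require Import structures.
From mathcomp Require Import all_boot all_order all_algebra ring_quotient.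
From mathcomp Require freeg.
From mathcomp Require Import boolp reals complex mpoly zify.
Set Implicit Arguments.
Unset Strict Implicit.
Unset Printing Implicit Defensive.
Import Order.TTheory GRing.Theory Num.Theory.
Local Open Scope ring_scope.
Local Open Scope quotient_scope.
Local Open Scope complex_scope.

(** * The grading group [L] and its rational degree *)

Section GradingGroup.

Variables (n : nat) (p : signature n).

Lemma L_eqP (u v : Lfree n) :
  reflect (exists s : {ffun 'I_n -> int},
             u - v = ([ffun i => s i * (p i)%:Z], - \sum_i s i))
          (\pi_(L p) u == \pi_(L p) v).
Proof. by rewrite eqmodE; apply: asboolP. Qed.

(** The rational degree on generators, normalized so that [c] has degree 1 and [X_i] has degree
    [1/p_i]. *)
Definition Lfree_weight (v : Lfree n) : rat :=
  \sum_i (v.1 i)%:~R / (p i)%:R + v.2%:~R.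

Definition weight (v : L p) : rat := Lfree_weight (repr v).

Lemma sig_neq0 i : (p i)%:R != 0 :> rat.
Proof. by rewrite pnatr_eq0 -lt0n sig_gt0. Qed.

Lemma Lfree_weightB (u v : Lfree n) :
  Lfree_weight (u - v) = Lfree_weight u - Lfree_weight v.
Proof.
rewrite /Lfree_weight /= opprD addrACA -mulrzBr -sumrB; congr (_ + _).
by apply: eq_bigr => i _; rewrite !ffunE mulrzBr mulrBl.
Qed.

(** Each relation [p_i X_i - c] has weight [p_i / p_i - 1 = 0], so the choice of representative does
    not matter. *)
Lemma weight_pi (u : Lfree n) : weight (\pi u) = Lfree_weight u.
Proof.
have /L_eqP[s us] : \pi_(L p) (repr (\pi_(L p) u)) == \pi u by rewrite reprK.
apply/eqP; rewrite /weight -subr_eq0 -Lfree_weightB us /Lfree_weight /=.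
rewrite mulrNz subr_eq0 (raddf_sum (intmul 1)) /=; apply/eqP.
apply: eq_bigr => i _.
by rewrite ffunE intrM -pmulrn mulfK ?sig_neq0.
Qed.

Lemma weight_is_additive : zmod_morphism weight.
Proof.
move=> u v; rewrite -[u]reprK -[v]reprK.
by rewrite -raddfB !weight_pi Lfree_weightB.
Qed.
HB.instance Definition _ := GRing.isZmodMorphism.Build (L p) rat weight
  weight_is_additive.

Lemma weight_Lx i : weight (Lx p i) = (p i)%:R^-1.
Proof.
rewrite weight_pi /Lfree_weight /= addr0 (bigD1 i) //= ffunE eqxx mul1r.
by rewrite big1 ?addr0 // => j ji; rewrite ffunE (negbTE ji) mul0r.
Qed.

Lemma weight_Lc : weight (Lc p) = 1.
Proof.
by rewrite weight_pi /Lfree_weight /= big1 ?add0r // => i _; rewrite ffunE mul0r.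
Qed.

(** The weight is [1 - \sum_i 1/p_i], so positivity is exactly the signature inequality. *)
Lemma weight_dualizing : 0 < weight (dualizing p).
Proof.
rewrite /dualizing raddfB raddf_sum /= weight_Lc subr_gt0.
rewrite (eq_bigr _ (fun i _ => weight_Lx i)).
exact: sig_lt1.
Qed.

(** [L] may have torsion, but an element of nonzero weight has infinite order. *)
Lemma dualizing_inj : injective (intmul (dualizing p)).
Proof.
move=> y z /(congr1 weight); rewrite !raddfMz; apply: mulrIz.
exact/lt0r_neq0/weight_dualizing.
Qed.

Lemma weight_monomial_degree m :
  weight (monomial_degree p m) = \sum_i (m i)%:R / (p i)%:R.
Proof.
rewrite /monomial_degree raddf_sum; apply: eq_bigr => i _.
by rewrite raddfMn /= weight_Lx mulr_natl.
Qed.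

(** Monomials have nonnegative weight and omega has positive weight. This allows degrees to be
    subtracted in [int] and then brought back to [nat]. *)
Lemma monomial_degree_ge0 m z :
  monomial_degree p m = dualizing p *~ z -> exists l : nat, z = l.
Proof.
move=> /(congr1 weight); rewrite raddfMz weight_monomial_degree /= => h.
suff : 0 <= z by case: z {h} => // l _; exists l.
rewrite -(@ler0z rat) -(pmulr_rge0 _ weight_dualizing) mulrzr -h.
by apply: sumr_ge0 => i _; rewrite divr_ge0 ?ler0n.
Qed.

(** One variable contributes [m_i / p_i] to a total weight of [l] times that of omega, and omega has
    weight at most 1. Hence each degree contains finitely many monomials. *)
Lemma monomial_degree_bound m (l : nat) i :
  monomial_degree p m = dualizing p *~ l -> (m i <= p i * l)%N.
Proof.
move=> /(congr1 weight); rewrite raddfMz weight_monomial_degree /= => h.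
rewrite -(@ler_nat rat) natrM mulrC -ler_pdivrMr ?ltr0n ?sig_gt0 //.
apply: (@le_trans _ _ (\sum_i (m i)%:R / (p i)%:R)).
  by rewrite (bigD1 i) //= lerDl sumr_ge0 // => j _; rewrite divr_ge0 ?ler0n.
rewrite h -mulrzr -[leRHS]mul1r ler_wpM2r ?ler0z //.
rewrite /dualizing raddfB raddf_sum /= weight_Lc gerBl sumr_ge0 // => j _.
by rewrite weight_Lx invr_ge0 ler0n.
Qed.

Lemma monomial_degreeD a b :
  monomial_degree p (a + b)%MM = monomial_degree p a + monomial_degree p b.
Proof.
by rewrite -big_split; apply: eq_bigr => i _; rewrite mnmDE mulrnDr.
Qed.

Lemma monomial_degreeB a b : (b <= a)%MM ->
  monomial_degree p (a - b)%MM = monomial_degree p a - monomial_degree p b.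
Proof. by move=> /submK {2}<-; rewrite monomial_degreeD addrK. Qed.

Lemma Lfree_mulrn (u : Lfree n) l :
  u *+ l = ([ffun i => u.1 i *+ l], u.2 *+ l) :> Lfree n.
Proof.
elim: l => [|l IHl]; first by congr pair; apply/ffunP=> i; rewrite !ffunE.
rewrite mulrS IHl; congr pair; last by rewrite mulrS.
by apply/ffunP=> i; rewrite !ffunE mulrS.
Qed.

Lemma Lx_sig i : Lx p i *+ p i = Lc p.
Proof.
rewrite /Lx /Lc -raddfMn /= Lfree_mulrn; apply/eqP/L_eqP.
exists [ffun l => (l == i)%:R]; congr pair.
  apply/ffunP => l; rewrite !ffunE subr0; case: eqP => [->|_].
    by rewrite /= mulr1n mul1r natz.
  by rewrite mul0r mul0rn.
rewrite /= mul0rn add0r (bigD1 i) //= ffunE eqxx big1 ?addr0 // => j ji.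
by rewrite ffunE (negbTE ji).
Qed.

(** * A common multiple of omega and [c] *)

Definition sig_prod : nat := \prod_i p i.
(** This is [P (1 - \sum_i 1/p_i)]; by [defect_gt0] the truncated subtraction is a true one. *)
Definition defect : nat := sig_prod - \sum_i sig_prod %/ p i.

Lemma dvdn_sig_prod i : (p i %| sig_prod)%N.
Proof. by rewrite /sig_prod (bigD1 i) //= dvdn_mulr. Qed.

Lemma sig_prod_gt0 : (0 < sig_prod)%N.
Proof. by rewrite prodn_gt0 // => i; apply: sig_gt0. Qed.

Lemma defect_gt0 : (0 < defect)%N.
Proof.
rewrite subn_gt0 -(@ltr_nat rat) natr_sum.
rewrite (eq_bigr (fun i => sig_prod%:R * (p i)%:R^-1)) => [|i _].
  by rewrite -mulr_sumr gtr_pMr ?ltr0n ?sig_prod_gt0 // sig_lt1.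
by rewrite -[in RHS](divnK (dvdn_sig_prod i)) natrM mulfK ?sig_neq0.
Qed.

Lemma dualizing_sig_prod : dualizing p *+ sig_prod = Lc p *+ defect.
Proof.
rewrite /dualizing mulrnBl -sumrMnl mulrnBr; last first.
  by rewrite ltnW // -subn_gt0 defect_gt0.
congr (_ - _); rewrite -sumrMnr; apply: eq_bigr => i _.
by rewrite -{1}(divnK (dvdn_sig_prod i)) mulnC mulrnA Lx_sig.
Qed.

End GradingGroup.

(** * Polynomials homogeneous for an additive weight on monomials *)

Section GradedPolynomials.

Variables (R : nzRingType) (n : nat) (V : nmodType) (w : 'X_{1..n} -> V).
Hypothesis wD : {morph w : a b / (a + b)%MM >-> a + b}.

(** The weight is abstract because it serves twice: for the degree in [L] and for the exponent of
    the distinguished variable. *)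
Definition homog_for (v : V) (q : {mpoly R[n]}) : Prop :=
  {in msupp q, forall m, w m = v}.

Lemma homog_for_sum v I (r : seq I) (P : pred I) (F : I -> {mpoly R[n]}) :
  (forall i, P i -> homog_for v (F i)) -> homog_for v (\sum_(i <- r | P i) F i).
Proof.
move=> hF; apply: (big_ind (homog_for v)) => //.
  by move=> m; rewrite msupp0.
by move=> q s hq hs m /msuppD_le; rewrite mem_cat => /orP[/hq|/hs].
Qed.

Lemma homog_forZ v a q : homog_for v q -> homog_for v (a *: q).
Proof. by move=> hq m /msuppZ_le /hq. Qed.

Lemma homog_forM u v q s :
  homog_for u q -> homog_for v s -> homog_for (u + v) (q * s).
Proof. by move=> hq hs m /msuppM_le /allpairsP[[a b] /= [/hq <- /hs <- ->]]. Qed.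

Lemma homog_forX m : homog_for (w m) 'X_[m].
Proof. by move=> l /mem_msuppXP <-. Qed.

Lemma homog_for_exp v q l : w 0%MM = 0 -> homog_for v q -> homog_for (v *+ l) (q ^+ l).
Proof.
move=> w0 hq; elim: l => [|l IHl]; last by rewrite exprS mulrS; apply: homog_forM.
by move=> m; rewrite msupp1 inE => /eqP ->.
Qed.

End GradedPolynomials.

(** * Normal forms modulo the Fermat relation *)

Section NormalForm.

Variables (k : fieldType) (n : nat) (p : signature n) (i0 : 'I_n).

Let tail : {mpoly k[n]} := \sum_(i | i != i0) 'X_i ^+ p i.

Lemma fermat_polyE : fermat_poly k p = 'X_i0 ^+ p i0 + tail.
Proof. by rewrite /fermat_poly (bigD1 i0). Qed.

Definition reduced (m : 'X_{1..n}) : 'X_{1..n} :=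
  [multinom if i == i0 then (m i %% p i)%N else m i | i < n].

(* The relation reads X_i0 ^ p_i0 = - tail. *)
Definition nf_mono (m : 'X_{1..n}) : {mpoly k[n]} :=
  (- tail) ^+ (m i0 %/ p i0) * 'X_[reduced m].

Definition nf (q : {mpoly k[n]}) : {mpoly k[n]} := freeg.fglift nf_mono (mpoly_val q).

Lemma nf_is_additive : zmod_morphism nf.
Proof. by move=> q s; rewrite /nf -freeg.lift_is_additive. Qed.
HB.instance Definition _ :=
  GRing.isZmodMorphism.Build {mpoly k[n]} {mpoly k[n]} nf nf_is_additive.

Lemma nf_term c m : nf (c *: 'X_[m]) = c *: nf_mono m.
Proof. by rewrite -MPolyU /nf /= freeg.liftU. Qed.

Lemma nfX m : nf 'X_[m] = nf_mono m.
Proof. by rewrite -[X in nf X]scale1r nf_term scale1r. Qed.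

Lemma nfE q : nf q = \sum_(m <- msupp q) q@_m *: nf_mono m.
Proof.
by rewrite {1}[q]mpolyE raddf_sum /=; apply: eq_bigr => m _; rewrite nf_term.
Qed.

Lemma nfZ c q : nf (c *: q) = c *: nf q.
Proof.
rewrite [q]mpolyE scaler_sumr !raddf_sum; apply: eq_bigr => m _ /=.
by rewrite scalerA !nf_term scalerA.
Qed.

(** A monomial free of [X_i0] changes neither the quotient nor the remainder of the exponent of
    [X_i0]. So [nf] is linear over the polynomials in the other variables. *)
Lemma nf_monoD m (l : 'X_{1..n}) : l i0 = 0%N -> nf_mono (m + l)%MM = nf_mono m * 'X_[l].
Proof.
move=> l0; rewrite /nf_mono mnmDE l0 addn0 -mulrA -mpolyXD; congr (_ * 'X_[_]).
apply/mnmP => i; rewrite !(mnmE, mnmDE).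
by case: eqP => // ->; rewrite l0 !addn0.
Qed.

Lemma nfMX q (l : 'X_{1..n}) : l i0 = 0%N -> nf (q * 'X_[l]) = nf q * 'X_[l].
Proof.
move=> l0; rewrite [q]mpolyE mulr_suml !raddf_sum mulr_suml.
apply: eq_bigr => m _ /=.
by rewrite -scalerAl -mpolyXD !nf_term nf_monoD // scalerAl.
Qed.

Lemma nfM_tail q : nf (q * tail) = nf q * tail.
Proof.
rewrite /tail !mulr_sumr raddf_sum; apply: eq_bigr => i ii0 /=.
by rewrite mpolyXn nfMX // mulmnE mnm1E (negbTE ii0).
Qed.

(** Adding [p i0] to the exponent of [X_i0] keeps the remainder and raises the quotient by one,
    which costs one factor [- tail]. *)
Lemma nfM_power q : nf (q * 'X_i0 ^+ p i0) = - (nf q * tail).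
Proof.
rewrite [q]mpolyE mulr_suml !raddf_sum mulr_suml -sumrN.
apply: eq_bigr => m _ /=.
rewrite mpolyXn -scalerAl -mpolyXD !nf_term -scalerAl -scalerN; congr (_ *: _).
have red : reduced (m + U_(i0) *+ p i0) = reduced m.
  apply/mnmP => i; rewrite [LHS]mnmE [RHS]mnmE mnmDE mulmnE mnm1E.
  by case: eqP => [->|]; rewrite ?eqxx ?mul1n ?modnDr // eq_sym => /eqP/negbTE->;
     rewrite mul0n addn0.
rewrite /nf_mono red mnmDE mulmnE mnm1E eqxx mul1n divnDr ?dvdnn //.
by rewrite divnn sig_gt0 addn1 exprSr -!mulrA [_ * tail]mulrC mulNr mulrN.
Qed.

(** The contributions of [X_i0 ^ p_i0] and of [tail] cancel, so [nf] factors through [T]. *)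
Lemma nf_ideal q : nf (q * fermat_poly k p) = 0.
Proof. by rewrite fermat_polyE mulrDr raddfD /= nfM_power nfM_tail addNr. Qed.

Lemma nf_id q : {in msupp q, forall m : 'X_{1..n}, m i0 < p i0}%N -> nf q = q.
Proof.
move=> hq; rewrite nfE [RHS]mpolyE; apply: eq_big_seq => m /hq m0.
rewrite /nf_mono divn_small // expr0 mul1r; congr (_ *: 'X_[_]).
by apply/mnmP => i; rewrite mnmE; case: eqP => // ->; rewrite modn_small.
Qed.

Lemma homog_for_nf (V : nmodType) (w : 'X_{1..n} -> V) (v : V) q :
  (forall m, homog_for w (w m) (nf_mono m)) ->
  homog_for w v q -> homog_for w v (nf q).
Proof.
move=> hm hq; rewrite nfE big_seq; apply: homog_for_sum => m /hq <-.
exact: homog_forZ.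
Qed.

(** [tail] does not involve [X_i0], so every term keeps the exponent of [reduced m]. The exact
    value, not only the bound by [p i0], is what the residue computation uses. *)
Lemma nf_mono_exp (m : 'X_{1..n}) :
  homog_for (fun l : 'X_{1..n} => l i0) (m i0 %% p i0)%N (nf_mono m).
Proof.
have wD : {morph (fun l : 'X_{1..n} => l i0) : a b / (a + b)%MM >-> (a + b)%R}.
  by move=> a b; rewrite mnmDE.
have -> : (m i0 %% p i0)%N = 0 *+ (m i0 %/ p i0) + reduced m i0 :> nat.
  by rewrite mul0rn add0r mnmE eqxx.
apply: homog_forM => //; last exact: homog_forX.
apply: homog_for_exp => //; first by rewrite mnm0E.
rewrite -scaleN1r; apply: homog_forZ; apply: homog_for_sum => i ii0.
have := @homog_forX k _ _ (fun l : 'X_{1..n} => l i0) (U_(i) *+ p i)%MM.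
by rewrite mpolyXn mulmnE mnm1E (negbTE ii0).
Qed.

Lemma nf_exp q (m : 'X_{1..n}) : m \in msupp (nf q) -> (m i0 < p i0)%N.
Proof.
rewrite nfE => /msupp_sum_le /flattenP[s /mapP[l _ ->]] /msuppZ_le.
by move=> /nf_mono_exp ->; rewrite ltn_mod sig_gt0.
Qed.

Lemma monomial_degree0 : monomial_degree p 0%MM = 0.
Proof. by rewrite /monomial_degree big1 // => i _; rewrite mnm0E. Qed.

Lemma monomial_degreeU i l : monomial_degree p (U_(i) *+ l)%MM = Lx p i *+ l.
Proof.
rewrite /monomial_degree (bigD1 i) //= big1 => [|j ji]; rewrite mulmnE mnm1E.
  by rewrite eqxx mul1n addr0.
by rewrite eq_sym (negbTE ji).
Qed.

(** Every [X_i ^ p_i] has degree [c], so replacing [X_i0 ^ p_i0] by [- tail] preserves the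
    degree. *)
Lemma nf_mono_degree m :
  homog_for (monomial_degree p) (monomial_degree p m) (nf_mono m).
Proof.
have -> : monomial_degree p m =
    Lc p *+ (m i0 %/ p i0) + monomial_degree p (reduced m).
  rewrite -(Lx_sig p i0) -mulrnA -monomial_degreeU -monomial_degreeD.
  congr monomial_degree; apply/mnmP => i; rewrite mnmDE mulmnE mnm1E mnmE.
  case: (eqVneq i i0) => [->|]; first by rewrite mul1n mulnC -divn_eq.
  by rewrite mul0n.
apply: homog_forM; [exact: monomial_degreeD| |exact: homog_forX].
apply: homog_for_exp; [exact: monomial_degreeD|exact: monomial_degree0|].
rewrite -scaleN1r; apply: homog_forZ; apply: homog_for_sum => i _.
by rewrite mpolyXn -(Lx_sig p i) -monomial_degreeU; apply: homog_forX.
Qed.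

Lemma T_pi_eqP q s :
  reflect (exists g, q - s = g * fermat_poly k p) (T_pi p q == T_pi p s).
Proof. by rewrite -Quotient.idealrBE; apply: asboolP. Qed.

Lemma T_pi_nf q : T_pi p (nf q) = T_pi p q.
Proof.
have piX : T_pi p ('X_i0 ^+ p i0) = T_pi p (- tail).
  by apply/eqP/T_pi_eqP; exists 1; rewrite mul1r opprK fermat_polyE.
have piXn l : T_pi p ((- tail) ^+ l) = T_pi p ('X_i0 ^+ (p i0 * l)).
  elim: l => [|l IHl]; first by rewrite muln0.
  by rewrite exprS T_piM -piX IHl -T_piM -exprD mulnS.
rewrite nfE [in RHS](mpolyE q) /T_pi !raddf_sum; apply: eq_bigr => m _ /=.
rewrite -!mul_mpolyC -!/(T_pi p _) !T_piM piXn -T_piM mpolyXn -mpolyXD.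
congr (_ * T_pi _ 'X_[_]); apply/mnmP => i; rewrite mnmDE mulmnE mnm1E mnmE.
case: (eqVneq i i0) => [->|]; first by rewrite mul1n mulnC -divn_eq.
by rewrite mul0n.
Qed.

Definition NF (x : T k p) : {mpoly k[n]} := nf (repr x).

Lemma NF_pi q : NF (T_pi p q) = nf q.
Proof.
have /T_pi_eqP[g e] : T_pi p (repr (T_pi p q)) == T_pi p q by rewrite /T_pi reprK.
by apply/eqP; rewrite /NF -subr_eq0 -raddfB e /= nf_ideal.
Qed.

Lemma NFK : cancel NF (T_pi p).
Proof. by move=> x; rewrite T_pi_nf /T_pi reprK. Qed.

Lemma NF_is_linear : linear NF.
Proof.
move=> c x y; rewrite -[x]NFK -[y]NFK.
have -> : c *: T_pi p (NF x) + T_pi p (NF y) = T_pi p (c *: NF x + NF y).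
  by rewrite T_piD -mul_mpolyC T_piM.
by rewrite !NF_pi raddfD /= nfZ.
Qed.
HB.instance Definition _ :=
  GRing.isLinear.Build k (T k p) {mpoly k[n]} *:%R NF NF_is_linear.

Lemma NF_exp x (m : 'X_{1..n}) : m \in msupp (NF x) -> (m i0 < p i0)%N.
Proof. exact: nf_exp. Qed.

Lemma NF_mulX x (l : 'X_{1..n}) : l i0 = 0%N -> NF (x * T_pi p 'X_[l]) = NF x * 'X_[l].
Proof.
move=> l0; rewrite -[in LHS](NFK x) -T_piM NF_pi nfMX // nf_id //.
exact: NF_exp.
Qed.

Lemma NF_id q : {in msupp q, forall m : 'X_{1..n}, m i0 < p i0}%N -> NF (T_pi p q) = q.
Proof. by move=> hq; rewrite NF_pi nf_id. Qed.

Lemma NF_homog v x m :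
  T_homog v x -> m \in msupp (NF x) -> monomial_degree p m = v.
Proof.
move=> [q <- hq]; rewrite NF_pi.
exact: (homog_for_nf nf_mono_degree hq).
Qed.

Lemma NF_expand x : x = \sum_(m <- msupp (NF x)) (NF x)@_m *: T_pi p 'X_[m].
Proof.
rewrite -{1}(NFK x) {1}[NF x]mpolyE /T_pi raddf_sum; apply: eq_bigr => m _ /=.
by rewrite -mul_mpolyC -/(T_pi p _) T_piM.
Qed.

End NormalForm.

Lemma mcoeffMX_if (R : nzRingType) (n : nat) (q : {mpoly R[n]}) m l :
  (q * 'X_[m])@_l = if (m <= l)%MM then q@_(l - m) else 0.
Proof.
case: ifP => ml; first by rewrite -{1}(submK ml) addmC mcoeffMX.
apply: memN_msupp_eq0; apply/negP; rewrite (perm_mem (msuppMX _ _)).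
by case/mapP => l' _ e; rewrite e lem_addr in ml.
Qed.

(** * Monomials and coordinates in the canonical ring *)

Section Residue.

Variables (k : fieldType) (d : nat) (p : signature d.+1).

Let A := canonical_ring k p.
Let omega := dualizing p.
Let D := defect p.
Let P := sig_prod p.

(** The default 0 is taken when the class of the monomial lies outside [R]; hence the degree
    hypotheses in the lemmas below. *)
Definition mono (m : 'X_{1..d.+1}) : A := insubd 0 (T_pi p 'X_[m]).

Lemma mono_val m (l : nat) : monomial_degree p m = omega *+ l ->
  val (mono m) = T_pi p 'X_[m].
Proof.
move=> hm; rewrite insubdK //; apply: (@canonical_subring_homog _ _ _ l).
by exists 'X_[m] => // m' /mem_msuppXP <-.
Qed.

Lemma mono_part m (l : nat) : monomial_degree p m = omega *+ l ->
  canonical_part l (mono m).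
Proof.
move=> hm; rewrite /canonical_part (mono_val hm).
by exists 'X_[m] => // m' /mem_msuppXP <-.
Qed.

Lemma monoM a b (l l' : nat) : monomial_degree p a = omega *+ l ->
  monomial_degree p b = omega *+ l' -> mono (a + b) = mono a * mono b.
Proof.
move=> ha hb; apply: val_inj; rewrite rmorphM /= (mono_val ha) (mono_val hb).
rewrite (@mono_val _ (l + l')) ?mpolyXD ?T_piM //.
by rewrite monomial_degreeD ha hb mulrnDr.
Qed.

Definition coords (y : A) : {mpoly k[d.+1]} := NF ord0 (val y).

Lemma coords_is_linear : linear coords.
Proof. by move=> c y z; rewrite /coords !linearP. Qed.
HB.instance Definition _ :=
  GRing.isLinear.Build k A {mpoly k[d.+1]} *:%R coords coords_is_linear.

Lemma coords_inj : injective coords.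
Proof. by move=> y z /(can_inj (NFK ord0)) /val_inj. Qed.

Lemma coords_exp y (m : 'X_{1..d.+1}) :
  m \in msupp (coords y) -> (m ord0 < p ord0)%N.
Proof. exact: NF_exp. Qed.

Lemma coords_part y l m : canonical_part l y -> m \in msupp (coords y) ->
  monomial_degree p m = omega *+ l.
Proof. exact: NF_homog. Qed.

Lemma coords_degree y m : m \in msupp (coords y) ->
  exists l : nat, monomial_degree p m = omega *+ l.
Proof.
have /canonical_subringP[N [z [hz e]]] := canonical_valP y.
rewrite /coords /= e raddf_sum => /msupp_sum_le /flattenP[s /mapP[l _ ->]].
move=> hm; exists l; apply: NF_homog (hz l) hm.
Qed.

Lemma coords_mono m (l : nat) : monomial_degree p m = omega *+ l ->
  (m ord0 < p ord0)%N -> coords (mono m) = 'X_[m].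
Proof.
move=> hm m0; rewrite /coords (mono_val hm) NF_id // => m'.
by move/mem_msuppXP <-.
Qed.

Lemma coords_mulX y m (l : nat) : monomial_degree p m = omega *+ l ->
  m ord0 = 0%N -> coords (y * mono m) = coords y * 'X_[m].
Proof.
by move=> hm m0; rewrite /coords rmorphM /= (mono_val hm) NF_mulX.
Qed.

Lemma coords_expand y :
  y = \sum_(m <- msupp (coords y)) (coords y)@_m *: mono m.
Proof.
apply: val_inj; rewrite linear_sum [LHS](NF_expand ord0).
apply: eq_big_seq => m hm; have [l hl] := coords_degree hm.
by rewrite linearZ -(mono_val hl).
Qed.

(** Converse to [coords_exp] and [coords_part]: these two conditions characterize the normal forms
    of elements of [R_l]. *)
Lemma coords_lift q (l : nat) :
  {in msupp q, forall m : 'X_{1..d.+1},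
     (m ord0 < p ord0)%N /\ monomial_degree p m = omega *+ l} ->
  exists2 y, canonical_part l y & coords y = q.
Proof.
move=> hq.
have hT : T_homog (omega *+ l) (T_pi p q) by exists q => // m /hq[].
have yP : val (insubd (0 : A) (T_pi p q)) = T_pi p q.
  by rewrite insubdK //; apply: (canonical_subring_homog hT).
exists (insubd 0 (T_pi p q)); first by rewrite /canonical_part yP.
by rewrite /coords yP NF_id // => m /hq[].
Qed.

(** * Socle monomials and residues *)

Definition ones : 'X_{1..d.+1} := [multinom 1%N | _ < d.+1].

(* Adding [ones] to all exponents lets the socle exponents p_i D t - 1 be
   written without truncated subtraction, including at t = 0. *)
Definition socle (t : nat) : 'X_{1..d.+1} :=
  [multinom if i == ord0 then p i else (p i * D * t)%N | i < d.+1].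

(** The value at [y / X^t] of a linear form on top local cohomology, where [X] is the product of the
    parameters. *)
Definition residue (t : nat) (y : A) : k := (coords y * 'X_[ones])@_(socle t).

Lemma residue_is_linear t : scalar (residue t).
Proof.
by move=> c y z; rewrite /residue linearP mulrDl -scalerAl mcoeffD mcoeffZ.
Qed.
HB.instance Definition _ t :=
  GRing.isLinear.Build k A k *%R (residue t) (residue_is_linear t).

Lemma residue_nf t (a b : 'X_{1..d.+1}) : (a ord0 < p ord0)%N -> (b ord0 < p ord0)%N ->
  (nf p ord0 ('X_[k, a] * 'X_[b]) * 'X_[ones])@_(socle t) =
  if (ones + b <= socle t)%MM then (a == socle t - (ones + b))%MM%:R else 0.
Proof.
move=> a0 b0; rewrite -mpolyXD.
have shift : (ones + b <= socle t)%MM ->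
    (a == socle t - (ones + b))%MM = (a + (ones + b) == socle t)%MM.
  by move=> le_b; rewrite -(eqm_add2r (ones + b)) submK.
case: (ltnP (a ord0 + b ord0) (p ord0)) => ab.
  rewrite nf_id => [|m /mem_msuppXP <-]; last by rewrite mnmDE.
  rewrite -mpolyXD mcoeffX -addmA [(b + ones)%MM]addmC.
  case: ifP => [/shift -> //|/negbT]; case: eqP => // <-.
  by rewrite lem_addl.
(* Here [X_0] wraps around and keeps an exponent at most [p_0 - 2], while the socle needs [p_0 - 1].
   On the right, [a + b] has exponent at least [p_0], so it is not the socle monomial either. *)
transitivity (0 : k).
  rewrite mcoeffMX_if; case: ifP => // _; apply: memN_msupp_eq0.
  apply/negP; rewrite nfX => /nf_mono_exp; rewrite mnmBE !mnmE eqxx.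
  by rewrite -(subnK ab) modnDr modn_small; lia.
case: ifP => // /shift ->; case: eqP => // /mnmP/(_ ord0).
by rewrite !mnmE eqxx; lia.
Qed.

(** Dual bases: by linearity in [y] and [residue_nf], only the monomial complementary to [b] in the
    socle contributes. *)
Lemma residueM t y (b : 'X_{1..d.+1}) (l : nat) :
  monomial_degree p b = omega *+ l -> (b ord0 < p ord0)%N ->
  residue t (y * mono b) =
  if (ones + b <= socle t)%MM then (coords y)@_(socle t - (ones + b)) else 0.
Proof.
move=> hb b0; rewrite {1}(coords_expand y) mulr_suml linear_sum /=.
have -> : (if (ones + b <= socle t)%MM
           then (coords y)@_(socle t - (ones + b)) else 0) =
    \sum_(m <- msupp (coords y)) (coords y)@_m *
      (if (ones + b <= socle t)%MM
       then (m == socle t - (ones + b))%MM%:R else 0).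
  case: ifP => _; last by rewrite big1 // => m _; rewrite mulr0.
  rewrite {1}(mpolyE (coords y)) raddf_sum; apply: eq_bigr => m _ /=.
  by rewrite mcoeffZ mcoeffX.
apply: eq_big_seq => m hm; rewrite -scalerAl linearZ /= -residue_nf //.
  by have [l' hl'] := coords_degree hm;
     rewrite /residue /coords rmorphM /= (mono_val hl') (mono_val hb) -T_piM NF_pi.
exact: coords_exp hm.
Qed.

(** * The parameters, and how residues behave under them *)

Definition scale_mnm (m : 'X_{1..d}) : 'X_{1..d.+1} :=
  [multinom if unlift ord0 i is Some j then (p i * D * m j)%N else 0%N | i < d.+1].

Lemma scale_mnm0 m : scale_mnm m ord0 = 0%N.
Proof. by rewrite mnmE unlift_none. Qed.

Lemma scale_mnm_lift m i : scale_mnm m (lift ord0 i) = (p (lift ord0 i) * D * m i)%N.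
Proof. by rewrite mnmE liftK. Qed.

Lemma scale_mnm_inj : injective scale_mnm.
Proof.
move=> a b /mnmP ab; apply/mnmP => i; have := ab (lift ord0 i).
rewrite !scale_mnm_lift => /eqP.
by rewrite eqn_pmul2l ?muln_gt0 ?sig_gt0 ?defect_gt0 // => /eqP.
Qed.

Lemma scale_mnmD a b : scale_mnm (a + b) = (scale_mnm a + scale_mnm b)%MM.
Proof.
apply/mnmP => i; rewrite mnmDE; case: (unliftP ord0 i) => [j|] ->.
  by rewrite !scale_mnm_lift mnmDE mulnDr.
by rewrite !scale_mnm0.
Qed.

(** Since [p_i X_i = c], each power [X_i ^ (p_i D)] has degree [D c = P omega]. *)
Lemma scale_mnm_degree m : monomial_degree p (scale_mnm m) = omega *+ (P * mdeg m).
Proof.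
rewrite /monomial_degree big_ord_recl scale_mnm0 mulr0n add0r.
rewrite mdegE mulrnA dualizing_sig_prod -sumrMnr; apply: eq_bigr => i _.
by rewrite scale_mnm_lift !mulrnA Lx_sig.
Qed.

Lemma mono_scaleD a b :
  mono (scale_mnm (a + b)) = mono (scale_mnm a) * mono (scale_mnm b).
Proof. by rewrite scale_mnmD (monoM (scale_mnm_degree _) (scale_mnm_degree _)). Qed.

Lemma mono_scale0 : mono (scale_mnm 0) = 1.
Proof.
apply: val_inj; rewrite (mono_val (scale_mnm_degree _)).
have -> : scale_mnm 0 = 0%MM.
  by apply/mnmP => i; rewrite mnmE mnm0E; case: unlift => // j; rewrite mnm0E muln0.
by rewrite mpolyX0 T_pi1.
Qed.

Definition param (i : 'I_d) : A := mono (scale_mnm U_(i)).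

Lemma param_exp i l : param i ^+ l = mono (scale_mnm (U_(i) *+ l)%MM).
Proof.
elim: l => [|l IHl]; first by rewrite mulm0n mono_scale0.
by rewrite exprS IHl mulmS mono_scaleD.
Qed.

Lemma mmap1_param m : mmap1 param m = mono (scale_mnm m).
Proof.
rewrite [in RHS](multinomUE_id m).
rewrite (big_morph (fun a => mono (scale_mnm a)) mono_scaleD mono_scale0).
by apply: eq_bigr => i _; rewrite param_exp.
Qed.

Lemma prod_param : \prod_i param i = mono (scale_mnm [multinom 1%N | _ < d]).
Proof.
by rewrite -mmap1_param; apply: eq_bigr => i _; rewrite mnmE expr1.
Qed.

Lemma socleD t s :
  socle (t + s) = (socle t + scale_mnm ([multinom 1%N | _ < d] *+ s))%MM.
Proof.
apply/mnmP => i; rewrite mnmDE; case: (unliftP ord0 i) => [j|] ->.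
  by rewrite scale_mnm_lift !mnmE mulmnE mnmE lift_eqF; lia.
by rewrite scale_mnm0 !mnmE eqxx addn0.
Qed.

Lemma socle_degree t :
  monomial_degree p (socle t) =
  monomial_degree p ones + omega *+ (t * \sum_(i < d) P).+1.
Proof.
have -> : socle t = (U_(ord0) *+ p ord0 + scale_mnm [multinom t | _ < d])%MM.
  apply/mnmP => i; rewrite mnmDE mulmnE mnm1E; case: (unliftP ord0 i) => [j|] ->.
    by rewrite scale_mnm_lift !mnmE lift_eqF.
  by rewrite scale_mnm0 mnmE eqxx; lia.
rewrite monomial_degreeD scale_mnm_degree monomial_degreeU Lx_sig.
have -> : monomial_degree p ones = \sum_i Lx p i.
  by apply: eq_bigr => i _; rewrite mnmE.
(* The factor [X_0 ^ p_0] has degree [c = \sum_i X_i + omega]. This single omega, beyond the degree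
   of [ones], is the value 1 of the a-invariant. *)
rewrite mulrS addrA; congr (_ + _ *+ _); first by rewrite addrC subrK.
rewrite mdegE (eq_bigr (fun=> t)) => [|i _]; last by rewrite mnmE.
by rewrite !sum_nat_const card_ord; lia.
Qed.

Lemma socle_degreeB t (b : 'X_{1..d.+1}) (z : int) :
  (ones + b <= socle t)%MM -> monomial_degree p b = omega *~ z ->
  monomial_degree p (socle t - (ones + b))%MM =
  omega *~ ((t * \sum_(i < d) P).+1%:Z - z).
Proof.
move=> le_b hb; rewrite monomial_degreeB // monomial_degreeD hb socle_degree.
by rewrite mulrzBr -pmulrn opprD addrACA subrr add0r.
Qed.

(** The factor forces an exponent of at least [p_i D t] on its variable, one more than the socle
    allows. *)
Lemma residue_param t i y : residue t (param i ^+ t * y) = 0.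
Proof.
rewrite mulrC param_exp /residue (coords_mulX _ (scale_mnm_degree _)) ?scale_mnm0 //.
rewrite -mulrA -mpolyXD mcoeffMX_if; case: ifP => // /mnm_lepP/(_ (lift ord0 i)).
rewrite mnmDE scale_mnm_lift mulmnE mnm1E eqxx !mnmE lift_eqF mul1n.
by rewrite addn1 ltnn.
Qed.

Lemma residue_prod t y : residue t.+1 ((\prod_i param i) * y) = residue t y.
Proof.
rewrite mulrC prod_param /residue (coords_mulX _ (scale_mnm_degree _)) ?scale_mnm0 //.
rewrite -mulrA -mpolyXD addmC mpolyXD mulrA -[t.+1]addn1 socleD mulm1n addmC.
by rewrite mcoeffMX.
Qed.

Lemma residue_part t l y : canonical_part l y ->
  l != (t * \sum_(i < d) P).+1 -> residue t y = 0.
Proof.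
move=> hy ne; rewrite /residue mcoeffMX_if; case: ifP => // le1.
apply: memN_msupp_eq0; apply: contraNN ne => /(coords_part hy).
rewrite -[in X in X -> _](addm0 ones) (@socle_degreeB _ _ 0) ?addm0 //; last first.
  by rewrite monomial_degree0 mulr0z.
by rewrite subr0 pmulrn => /dualizing_inj [->].
Qed.

Lemma param_part i : canonical_part P (param i).
Proof. by apply: mono_part; rewrite scale_mnm_degree mdeg1 muln1. Qed.

Lemma ones_le_socle t (a : 'X_{1..d.+1}) :
  (a ord0 < p ord0)%N -> (mdeg a < t)%N -> (ones + a <= socle t)%MM.
Proof.
move=> a0 at_; apply/mnm_lepP => i; rewrite mnmDE !mnmE.
case: eqP => [->//|_]; rewrite add1n; apply: (@leq_trans t).
  by rewrite (leq_ltn_trans _ at_) // mdegE (bigD1 i) //= leq_addr.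
by rewrite leq_pmull // muln_gt0 sig_gt0 defect_gt0.
Qed.

(** Nondegeneracy: at a level [t] above the total degree of [a], the monomial [a] divides the socle
    monomial, and [b] is the complementary factor. *)
Lemma residue_coef (a : 'X_{1..d.+1}) (z : int) :
  (a ord0 < p ord0)%N -> monomial_degree p a = omega *~ z ->
  exists t (b : A), forall y, residue t (y * b) = (coords y)@_a.
Proof.
move=> a0 ha; set t := (mdeg a).+1.
have le_a : (ones + a <= socle t)%MM by apply: ones_le_socle.
have hb := socle_degreeB le_a ha.
have [l hl] := monomial_degree_ge0 hb; rewrite hl in hb.
set b := (socle t - (ones + a))%MM in hb.
have bE : (socle t = a + (ones + b))%MM.
  by rewrite -(submK le_a) -/b; apply/mnmP => i; rewrite !mnmDE; lia.
exists t, (mono b) => y; rewrite (residueM _ _ hb).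
  by rewrite bE lem_addl addmK.
(* The exponent of [X_0] in [b] is [p_0 - 1 - a_0], so [b] is a normal monomial. *)
have := congr1 (fun m : 'X_{1..d.+1} => m ord0) bE.
by rewrite !mnmDE !mnmE eqxx; have := a0; lia.
Qed.

Lemma param_hsop : hsop (@canonical_part k _ p) param (fun=> P).
Proof.
split.
- by move=> i; rewrite sig_prod_gt0; split => //; apply: param_part.
- move=> q q0; apply/mpolyP => m; rewrite mcoeff0.
  (* Parameter monomials avoid [X_0], hence are normal; [scale_mnm_inj] keeps them distinct, so the
     coefficients of [q] can be read off. *)
  have : coords (mmap (in_alg A) param q) = \sum_(l <- msupp q) q@_l *: 'X_[scale_mnm l].
    rewrite /mmap raddf_sum; apply: eq_bigr => l _ /=.
    rewrite -scalerAl mul1r mmap1_param linearZ /= (coords_mono (scale_mnm_degree _)) //.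
    by rewrite scale_mnm0 sig_gt0.
  rewrite q0 linear0 => /(congr1 (mcoeff (scale_mnm m))); rewrite mcoeff0 => {q0} q0.
  rewrite q0 {1}(mpolyE q) !raddf_sum; apply: eq_bigr => l _ /=.
  by rewrite !mcoeffZ !mcoeffX (inj_eq scale_mnm_inj).
(* Dividing the exponents of [X_i], [i <> 0], by [p_i D] leaves remainders whose total degree, with
   the exponent of [X_0], is below [K]. The finitely many monomials of degree below [K] therefore
   generate. *)
- pose K := (p ord0 + \sum_(i < d) p (lift ord0 i) * D).+1.
  pose B := 'X_{1..d.+1 < K}.
  exists #|{: B}|, (fun s => mono (enum_val s : B)) => y.
  rewrite (coords_expand y) big_seq.
  apply: (big_ind (fun y => exists q : 'I_#|{: B}| -> {mpoly k[d]},
    y = \sum_s mmap (in_alg A) param (q s) * mono (enum_val s : B))).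
  + by exists (fun=> 0); rewrite big1 // => s _; rewrite mmap0 mul0r.
  + move=> _ _ [q ->] [r ->]; exists (fun s => q s + r s).
    by rewrite -big_split; apply: eq_bigr => s _; rewrite mmapD mulrDl.
  move=> m hm; have m0 := coords_exp hm; have [l hl] := coords_degree hm.
  move: (coords y)@_m => c.
  pose quo := [multinom (m (lift ord0 i) %/ (p (lift ord0 i) * D))%N | i < d].
  pose rem := [multinom if i == ord0 then m i else (m i %% (p i * D))%N | i < d.+1].
  have mE : m = (scale_mnm quo + rem)%MM.
    apply/mnmP => i; rewrite mnmDE; case: (unliftP ord0 i) => [j|] ->.
      by rewrite scale_mnm_lift !mnmE lift_eqF mulnC -divn_eq.
    by rewrite scale_mnm0 mnmE eqxx.
  have remK : (mdeg rem < K)%N.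
    rewrite mdegE big_ord_recl mnmE eqxx ltnS leq_add ?(ltnW m0) //.
    apply: leq_sum => i _; rewrite mnmE lift_eqF ltnW // ltn_mod.
    by rewrite muln_gt0 sig_gt0 defect_gt0.
  (* The remainder must itself lie in [R]: its degree is an integer multiple of omega, and that
     multiple is nonnegative. *)
  have : monomial_degree p rem = omega *~ (l%:Z - (P * mdeg quo)%N%:Z).
    rewrite mulrzBr -!pmulrn -hl -scale_mnm_degree mE monomial_degreeD.
    by rewrite addrC addKr.
  move=> hrem; have [l' hl'] := monomial_degree_ge0 hrem; rewrite hl' in hrem.
  pose s0 := enum_rank (BMultinom remK).
  exists (fun s => if s == s0 then c *: 'X_[quo] else 0).
  rewrite (bigD1 s0) //= eqxx big1 => [|s /negbTE ->]; last by rewrite mmap0 mul0r.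
  rewrite addr0 enum_rankK /= mmapZ mmapX mmap1_param /= -!scalerAl mul1r.
  by rewrite mE (monoM (scale_mnm_degree _) hrem).
Qed.

(** * The residue pairing identifies [R] with its canonical module *)

Definition duality (y : A) (t : nat) (w : A) : k := residue t (y * w).

Lemma duality_canonical (j : int) y : degree_part (@canonical_part k _ p) (j + 1) y ->
  canonical_module (@canonical_part k _ p) param (fun=> P) j (duality y).
Proof.
move=> hy; rewrite /duality; split.
- by move=> t c u v; rewrite mulrDr -scalerAr linearP.
- by move=> t i w; rewrite mulrCA residue_param.
- by move=> t w; rewrite mulrCA residue_prod.
move=> t m w hw ne; move: hy; case E : (j + 1) => [l|l] /=; last first.
  by move=> ->; rewrite mul0r linear0.
(* With [l = j + 1], hitting the socle degree would give [m - t deg X = 1 - l = - j], the excluded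
   case. *)
move=> hy; apply: (@residue_part _ (l + m)%N).
  by rewrite /canonical_part mulrnDr rmorphM; apply: T_homogM.
apply: contraNneq ne => e; apply/eqP.
by move: (t * _)%N e => u; lia.
Qed.

(** By [residue_coef], each coefficient of a normal form is a value of the pairing. *)
Lemma duality_inj (j : int) y z :
  degree_part (@canonical_part k _ p) j y -> degree_part (@canonical_part k _ p) j z ->
  duality y = duality z -> y = z.
Proof.
have supp u a : degree_part (@canonical_part k _ p) j u -> a \in msupp (coords u) ->
    (a ord0 < p ord0)%N /\ monomial_degree p a = omega *~ j.
  case: j => [l|l] /=; last by move=> ->; rewrite linear0 msupp0.
  by move=> hu ha; rewrite -pmulrn; split; [apply: coords_exp ha|apply: coords_part ha].
move=> hy hz yz; apply: coords_inj; apply/mpolyP => a.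
have eq_coef : (a ord0 < p ord0)%N /\ monomial_degree p a = omega *~ j ->
    (coords y)@_a = (coords z)@_a.
  by move=> [a0 ha]; have [t [b hb]] := residue_coef a0 ha;
     rewrite -!hb -!/(duality _ _ _) yz.
have [ya|ya] := boolP (a \in msupp (coords y)).
  exact: eq_coef (supp _ _ hy ya).
have [za|za] := boolP (a \in msupp (coords z)).
  exact: eq_coef (supp _ _ hz za).
by rewrite !memN_msupp_eq0.
Qed.

Section Surjectivity.

Variables (j : int) (phi : nat -> A -> k).
Hypothesis phiP : canonical_module (@canonical_part k _ p) param (fun=> P) j phi.

Lemma canonical_module_sum t I (r : seq I) (c : I -> k) (u : I -> A) :
  phi t (\sum_(i <- r) c i *: u i) = \sum_(i <- r) c i * phi t (u i).
Proof.
case: phiP => lin _ _ _; have phi0 : phi t 0 = 0.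
  by have := lin t (-1) 0 0; rewrite scaler0 addr0 mulN1r addNr.
by elim/big_rec2: _ => // i _ v _ <-; rewrite lin.
Qed.

Lemma canonical_module_shift t s b (l : nat) : monomial_degree p b = omega *+ l ->
  phi (t + s) (mono (b + scale_mnm ([multinom 1%N | _ < d] *+ s))) = phi t (mono b).
Proof.
case: phiP => _ _ shift _ hb.
rewrite (monoM hb (scale_mnm_degree _)) mulrC.
elim: s => [|s IHs]; first by rewrite mulm0n mono_scale0 mul1r addn0.
by rewrite addnS mulmS mono_scaleD -mulrA -prod_param shift.
Qed.

(** The dual bases force the choice of [y]: its coefficient at [a] is the value of [phi] on the
    monomial complementary to [a]. *)
Lemma duality_surj : exists2 y,
  degree_part (@canonical_part k _ p) (j + 1) y & duality y = phi.
Proof.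
(* By [monomial_degree_bound], this one level exceeds the total degree of every monomial of degree
   [(j + 1) omega], so it serves all coefficients. *)
pose K := (\sum_i p i * `|(j + 1)%R|).+1%N.
pose cond (a : 'X_{1..d.+1}) :=
  (a ord0 < p ord0)%N && (monomial_degree p a == omega *~ (j + 1)).
pose c (a : 'X_{1..d.+1}) :=
  if cond a then phi K (mono (socle K - (ones + a))) else 0.
have condK a : cond a -> (mdeg a < K)%N.
  case/andP => _ /eqP ha; rewrite ltnS mdegE; apply: leq_sum => i _.
  have [l hl] := monomial_degree_ge0 ha; rewrite hl in ha *.
  exact: monomial_degree_bound ha.
have [y hy yE] : exists2 y, degree_part (@canonical_part k _ p) (j + 1) y &
    forall a, (coords y)@_a = c a.
  pose q : {mpoly k[d.+1]} := \sum_(a : 'X_{1..d.+1 < K}) c a *: 'X_[a].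
  have qE a : q@_a = c a.
    case: (ltnP (mdeg a) K) => [aK|Ka]; first by rewrite mcoeff_mpoly.
    rewrite /c; case: ifP => [/condK|_]; first by rewrite ltnNge Ka.
    rewrite /q raddf_sum big1 // => b _ /=; rewrite mcoeffZ mcoeffX.
    by case: eqP => [ba|]; [move: (bmdeg b); rewrite ba ltnNge Ka|rewrite mulr0].
  have supp a : a \in msupp q -> cond a.
    by rewrite mcoeff_msupp qE /c; case: ifP => // _; rewrite eqxx.
  case E : (j + 1) => [l|l] /=.
    have [a /supp/andP[-> /eqP ->]|y hy yq] := @coords_lift q l.
      by rewrite E -pmulrn.
    by exists y => // a; rewrite yq qE.
  (* For negative [j + 1] there are no monomials of that degree, so every [c a] is 0. *)
  exists 0 => // a; rewrite linear0 mcoeff0 /c; case: ifP => // /andP[_ /eqP].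
  by rewrite E => /monomial_degree_ge0[].
exists y => //; case: (phiP) => lin param0 _ phi_deg.
apply/funext => t; apply/funext => w.
rewrite (coords_expand w) canonical_module_sum /duality mulr_sumr linear_sum.
apply: eq_big_seq => b /= hb; have b0 := coords_exp hb.
have [m hm] := coords_degree hb; rewrite -scalerAr linearZ /=; congr (_ * _).
rewrite (residueM _ _ hm) //; case: ifP => [le_b|/negP le_b].
  set a := (socle t - (ones + b))%MM; rewrite yE.
  have aE : (ones + a + b = socle t)%MM
    by rewrite -[RHS](submK le_b) -/a; apply/mnmP => i; rewrite !mnmDE; lia.
  have ha : monomial_degree p a = omega *~ ((t * \sum_(i < d) P).+1%:Z - m%:Z).
    exact: (socle_degreeB le_b).
  have a0 : (a ord0 < p ord0)%N by rewrite mnmBE mnmDE !mnmE eqxx; have := b0; lia.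
  rewrite /c /cond a0 ha /= (inj_eq (@dualizing_inj _ p)).
  (* If [a] has the wrong degree, its coefficient is 0, and so is [phi t (mono b)] because [phi] has
     degree [j]. *)
  case: eqP => [e|ne]; last first.
    rewrite (phi_deg _ m) //; first exact: mono_part.
    by apply/eqP => e; apply: ne; move: (t * _)%N e => u; lia.
  have aK : (mdeg a < K)%N by apply: condK; rewrite /cond a0 ha e /=.
  have le_a : (ones + a <= socle K)%MM by apply: ones_le_socle.
  have hb' := socle_degreeB le_a ha.
  set b' := (socle K - (ones + a))%MM in hb' *.
  have [l hl] := monomial_degree_ge0 hb'; rewrite hl in hb'.
  (* Both values are moved to level [t + K], where the two monomials coincide: each complements [a]
     in the same socle monomial. *)
  rewrite -(canonical_module_shift K t hb') -(canonical_module_shift t K hm) addnC.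
  congr (phi _ (mono _)); apply: (@addmI _ (ones + a)%MM).
  by rewrite !addmA aE [(ones + a + b')%MM]addmC submK // -!socleD addnC.
(* The exponent of [X_0] in [b] is below [p_0], so failure to divide the socle comes from another
   variable. Then [b] is divisible by the [t]-th power of a parameter, and [phi t] vanishes on
   it. *)
have [/existsP[i hi]|/existsPn hn] :=
  boolP [exists i : 'I_d, p (lift ord0 i) * D * t <= b (lift ord0 i)]%N; last first.
  case: le_b; apply/mnm_lepP => i; rewrite mnmDE !mnmE.
  case: (unliftP ord0 i) => [i'|] ->; last by rewrite eqxx.
  by rewrite lift_eqF add1n ltnNge hn.
set s := scale_mnm (U_(i) *+ t).
have le_s : (s <= b)%MM.
  apply/mnm_lepP => l; case: (unliftP ord0 l) => [l'|] ->; last by rewrite scale_mnm0.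
  rewrite scale_mnm_lift mulmnE mnm1E.
  by case: eqP => [<-|_]; rewrite ?mul1n ?mul0n ?muln0.
have hbs : monomial_degree p (b - s)%MM =
    omega *~ (m%:Z - (P * mdeg (U_(i) *+ t)%MM)%N%:Z).
  by rewrite monomial_degreeB // hm scale_mnm_degree mulrzBr !pmulrn.
have [l hl] := monomial_degree_ge0 hbs; rewrite hl in hbs.
have -> : mono b = param i ^+ t * mono (b - s).
  by rewrite param_exp -(monoM (scale_mnm_degree _) hbs) addmC submK.
by rewrite param0.
Qed.

End Surjectivity.

End Residue.

Theorem theorem1p4 (Rr : realType) (n : nat) (p : signature n) :
  (4 <= n)%N ->
  hypersurface (@canonical_part Rr[i] n p) ->
  a_invariant (@canonical_part Rr[i] n p) 1.
Proof.
case: n p => // d p _ _.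
exists d, (param Rr[i] p), (fun=> sig_prod p); split; first exact: param_hsop.
exists (@duality Rr[i] d p); split.
- by move=> y z t w; rewrite /duality mulrDl raddfD.
- by move=> y z t w; rewrite /duality -mulrA mulrCA.
- exact: duality_canonical.
move=> j phi /duality_surj[y hy yphi]; exists y; split => // z [hz zphi].
by apply: (duality_inj hy hz); rewrite yphi zphi.
Qed.
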